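(* Let $H$ be a complex Hilbert space and let $A:\mathcal{D}(A)\subset H\to H$ be a closed, densely defined linear operator. Consider a set $S\subset\varrho(A)$ such that $$M:=\sup_{s\in S}\|(A-s)^{-1}\|<\infty.$$ Then for $0<\varepsilon<\frac1M$ we have the inclusion $$\sigma_\varepsilon(A)\subset\bigcap_{s\in S}\left[\bigl(B_{\delta_s}(W((A-s)^{-1}))\bigr)^{-1}+s\right],$$ where $\delta_s=\dfrac{\|(A-s)^{-1}\|^2\varepsilon}{1-\|(A-s)^{-1}\|\varepsilon}$.
   Context: $\varrho(A)$ is the resolvent set and $\sigma(A)=\mathbb{C}\setminus\varrho(A)$ the spectrum of $A$; $\|\cdot\|$ is the operator norm on bounded operators on $H$. For $\varepsilon>0$ the $\varepsilon$-pseudospectrum is $\sigma_\varepsilon(A)=\sigma(A)\cup\{\lambda\in\varrho(A): \|(A-\lambda)^{-1}\|>\frac1\varepsilon\}$. The numerical range of an operator $T$ is $W(T)=\{\langle Tx,x\rangle: x\in\mathcal{D}(T),\ \|x\|=1\}$. For $U\subset\mathbb{C}$ and $\delta>0$: $B_\delta(U)=\{z\in\mathbb{C}:\operatorname{dist}(z,U)<\delta\}$, $U^{-1}=\{z^{-1}: z\in U\setminus\{0\}\}$, and $U+s=\{z+s: z\in U\}$. *)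

(* Defs.v *)
From HB Require Import structures.
From mathcomp Require Import all_boot all_order all_algebra.
From mathcomp Require Import all_classical all_reals all_analysis.
From mathcomp Require Import complex.

Set Implicit Arguments.
Unset Strict Implicit.
Unset Printing Implicit Defensive.

Import Order.TTheory GRing.Theory Num.Theory.
Import numFieldNormedType.Exports.

Local Open Scope classical_set_scope.
Local Open Scope ring_scope.

(* In a normed space over R[i] (and in R[i] itself) the norm `|x| is an element
   of R[i] with zero imaginary part; rnorm x is the same number as an element
   of R. *)
Definition rnorm (R : realType) (V : normedZmodType R[i]) (x : V) : R :=
  complex.Re `|x|.

(* A linear operator D(A) -> H defined on a linear subspace D(A) of H. It is
   represented by a function on all of H whose values outside of D(A) are
   arbitrary and never used. *)
Record operator (R : realType) (H : normedModType R[i]) := Operator {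
  dom : set H ;
  app :> H -> H ;
  dom0 : dom 0 ;
  dom_linear : forall (a : R[i]) (x y : H),
    dom x -> dom y -> dom (a *: x + y) ;
  app_linear : forall (a : R[i]) (x y : H),
    dom x -> dom y -> app (a *: x + y) = a *: app x + app y }.

Section Spectral.
Context {R : realType} {H : completeNormedModType R[i]}.
Implicit Types (A : operator H) (T : H -> H) (lambda : R[i]).

Definition closed_operator A : Prop :=
  closed [set p : H * H | dom A p.1 /\ p.2 = A p.1].

Definition densely_defined A : Prop := dense (dom A).

Definition bounded_operator T : Prop :=
  exists C : R, forall x, rnorm (T x) <= C * rnorm x.

Definition opnorm T : R := sup [set rnorm (T x) | x in [set x | rnorm x <= 1]].

Definition shift A lambda : H -> H := fun x => A x - lambda *: x.

(* (A - lambda)^-1, the inverse of the restriction of A - lambda to D(A). *)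
Definition resolvent A lambda : H -> H :=
  'pinv_(fun=> 0) (dom A) (shift A lambda).

Definition resolvent_set A : set R[i] :=
  [set lambda | set_bij (dom A) [set: H] (shift A lambda) /\
                bounded_operator (resolvent A lambda)].

Definition spectrum A : set R[i] := ~` resolvent_set A.

Definition pseudospectrum A (eps : R) : set R[i] :=
  spectrum A `|`
  [set lambda | resolvent_set A lambda /\ eps^-1 < opnorm (resolvent A lambda)].

(* The operator is T restricted to D. *)
Definition numerical_range (dot : {dot H for Num.conj}) (D : set H) T : set R[i] :=
  [set dot (T x) x | x in [set x | D x /\ rnorm x = 1]].

End Spectral.

Section ComplexSets.
Context {R : realType}.
Implicit Types (U : set R[i]) (z s : R[i]).

(* Extended-real valued, so that the distance to the empty set is +oo. *)
Definition dist_set z U : \bar R := ereal_inf [set (rnorm (z - w))%:E | w in U].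

Definition nbhd_set (delta : R) U : set R[i] :=
  [set z | (dist_set z U < delta%:E)%E].

Definition inv_set U : set R[i] := [set z^-1 | z in U `\ 0].

Definition translate U s : set R[i] := [set z + s | z in U].

End ComplexSets.

Definition delta_ {R : realType} {H : completeNormedModType R[i]}
    (A : operator H) (eps : R) (s : R[i]) : R :=
  opnorm (resolvent A s) ^+ 2 * eps / (1 - opnorm (resolvent A s) * eps).

(* M = sup_(s in S) ||(A - s)^-1||; the supremum of the empty set is 0. *)
Definition resolvent_bound {R : realType} {H : completeNormedModType R[i]}
    (A : operator H) (S : set R[i]) : R :=
  sup [set opnorm (resolvent A s) | s in S].

(* Main.v *)
(* Let T = (A - s)^-1, a = lambda - s, and let lambda be in the pseudospectrum.
   If some unit vector x has |(A - lambda) x| < eps, put y = (A - lambda) x: then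
   x = T y + a T x, so 1 - a <T x, x> = <T y, x> is smaller than |T| eps, while
   |a| >= (1 - |T| eps) / |T|. Otherwise lambda is in the spectrum and
   A - lambda is bounded below, so the range of 1 - a T = (A - lambda) T is not
   dense; a unit vector y almost orthogonal to this range makes
   1 - a <T y, y> = <(1 - a T) y, y> arbitrarily small. In both cases 1 / a is
   within delta_s of the numerical range of T. *)

Require Import Defs.
From HB Require Import structures.
From mathcomp Require Import all_boot all_order all_algebra.
From mathcomp Require Import all_classical all_reals all_analysis.
From mathcomp Require Import complex ring lra.

Set Implicit Arguments.
Unset Strict Implicit.
Unset Printing Implicit Defensive.

Import Order.TTheory GRing.Theory Num.Theory.
Import numFieldNormedType.Exports.
Local Open Scope classical_set_scope.
Local Open Scope ring_scope.

(** * Norms taken as real numbers *)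

Section RealNorm.
Context {R : realType} {V : normedZmodType R[i]}.
Implicit Types x y : V.

Lemma rnormE x : `|x| = (rnorm x)%:C%C.
Proof. by rewrite /rnorm RRe_real// normr_real. Qed.

Lemma rnorm_ge0 x : 0 <= rnorm x.
Proof. by rewrite -ler0c -rnormE. Qed.

Lemma rnorm0 : rnorm (0 : V) = 0.
Proof. by rewrite /rnorm normr0. Qed.

Lemma rnorm_eq0 x : (rnorm x == 0) = (x == 0).
Proof. by rewrite -(normr_eq0 x) rnormE fmorph_eq0. Qed.

Lemma rnorm_gt0 x : (0 < rnorm x) = (x != 0).
Proof. by rewrite lt_def rnorm_eq0 rnorm_ge0 andbT. Qed.

Lemma rnormN x : rnorm (- x) = rnorm x.
Proof. by rewrite /rnorm normrN. Qed.

Lemma ler_rnormD x y : rnorm (x + y) <= rnorm x + rnorm y.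
Proof. by rewrite -lecR rmorphD/= -!rnormE ler_normD. Qed.

End RealNorm.

Lemma rnormZ (R : realType) (H : normedModType R[i]) (a : R[i]) (x : H) :
  rnorm (a *: x) = rnorm a * rnorm x.
Proof. by apply: complexI; rewrite rmorphM/= -!rnormE normrZ. Qed.

Lemma rnormM (R : realType) (a b : R[i]) : rnorm (a * b) = rnorm a * rnorm b.
Proof. by apply: complexI; rewrite rmorphM/= -!rnormE normrM. Qed.

Lemma rnormC (R : realType) (r : R) : 0 <= r -> rnorm (r%:C%C) = r.
Proof. by move=> r0; rewrite /rnorm ger0_norm ?ler0c. Qed.

Lemma rnorm_unit (R : realType) (H : normedModType R[i]) (x : H) :
  x != 0 -> rnorm ((rnorm x)^-1%:C%C *: x) = 1.
Proof.
rewrite -rnorm_eq0 => x0; rewrite rnormZ rnormC ?invr_ge0 ?rnorm_ge0//.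
exact: mulVf.
Qed.

(** Multiplying [a^-1 - w] by [a] gives [1 - a * w]. With [w] in the numerical range of a resolvent,
    this turns a small inner product into closeness to [a^-1]. *)
Lemma rnorm_inv_sub (R : realType) (a w : R[i]) (delta : R) : a != 0 ->
  rnorm (1 - a * w) < delta * rnorm a -> rnorm (a^-1 - w) < delta.
Proof.
move=> a0; rewrite -[in X in _ -> X](ltr_pM2r (_ : 0 < rnorm a)) ?rnorm_gt0//.
by rewrite -rnormM mulrBl mulVf// (mulrC w).
Qed.

(** * Operator norms and surjectivity of bounded linear operators *)

Section LinearOperators.
Context {R : realType} {H : completeNormedModType R[i]}.
Variable T : H -> H.

Lemma opnorm_le (C : R) : 0 <= C ->
  (forall x, rnorm (T x) <= C * rnorm x) -> opnorm T <= C.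
Proof.
move=> C0 TC; apply: ge_sup; first by exists (rnorm (T 0)), 0 => //=; rewrite rnorm0.
move=> _ [x /= x1 <-]; apply: le_trans (TC x) _.
by rewrite -[leRHS]mulr1 ler_wpM2l.
Qed.

Hypothesis T_linear : linear T.

Lemma linear_op0 : T 0 = 0.
Proof.
apply: (addIr (T 0)); rewrite add0r.
by have := T_linear 1 0 0; rewrite !scale1r addr0.
Qed.

Lemma linear_opZ a x : T (a *: x) = a *: T x.
Proof. by rewrite -[a *: x]addr0 T_linear linear_op0 addr0. Qed.

Lemma linear_id_subZ a : linear (fun x => x - a *: T x).
Proof.
move=> b x y; rewrite T_linear [a *: _]scalerDr opprD addrACA scalerBr !scalerA.
by rewrite (mulrC a).
Qed.

Lemma opnorm_has_ubound : bounded_operator T ->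
  has_ubound [set rnorm (T x) | x in [set x | rnorm x <= 1]].
Proof.
move=> [C TC]; exists `|C| => _ [y /= y1 <-]; apply: le_trans (TC y) _.
apply: (@le_trans _ _ (`|C| * rnorm y)).
  by rewrite ler_wpM2r ?rnorm_ge0// ler_norm.
by rewrite -[leRHS]mulr1 ler_wpM2l.
Qed.

Lemma opnorm_bound x : bounded_operator T -> rnorm (T x) <= opnorm T * rnorm x.
Proof.
move=> T_bounded; have [->|x0] := eqVneq x 0.
  by rewrite linear_op0 !rnorm0 mulr0.
rewrite -ler_pdivrMr ?rnorm_gt0// mulrC.
rewrite -{1}(@rnormC _ (rnorm x)^-1) ?invr_ge0 ?rnorm_ge0//.
rewrite -rnormZ -linear_opZ; apply: (ub_le_sup (opnorm_has_ubound T_bounded)).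
by exists ((rnorm x)^-1%:C%C *: x) => //=; rewrite rnorm_unit.
Qed.

Lemma opnorm_ge0 : bounded_operator T -> 0 <= opnorm T.
Proof.
move=> T_bounded; apply: (ub_le_sup (opnorm_has_ubound T_bounded)).
by exists 0; rewrite /= ?linear_op0 rnorm0 ?ler01.
Qed.

(** The lower bound makes approximate preimages of [y] Cauchy; completeness gives a limit, and the
    upper bound carries [T] to it. *)
Lemma dense_range_surj (C c : R) : 0 < c ->
  (forall x, rnorm (T x) <= C * rnorm x) ->
  (forall x, c * rnorm x <= rnorm (T x)) ->
  (forall y e, 0 < e -> exists x, rnorm (T x - y) < e) ->
  forall y, exists x, T x = y.
Proof.
move=> c0 TC Tc Tdense y.
have TB x x' : T (x - x') = T x - T x'.
  by rewrite addrC -scaleN1r T_linear scaleN1r addrC.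
pose F := filter_from [set e : R | 0 < e] (fun e => [set x | rnorm (T x - y) < e]).
have FF : ProperFilter F.
  apply: filter_from_proper; last by move=> e /= /(Tdense y).
  apply: filter_from_filter; first by exists 1 => /=.
  move=> e e' /= e0 e'0; exists (Num.min e e') => /=; first by rewrite lt_min e0.
  by move=> x /=; rewrite lt_min => /andP[].
have : cvg F.
  apply: cauchy_cvg; apply: cauchy_exP => e e0.
  have /complex_realP[r er] : e \is Num.real by rewrite gtr0_real.
  move: e0; rewrite {}er (ltcR 0 r) => r0.
  (* Two points whose images lie within [c * r / 2] of [y] have images less than [c * r] apart,
     hence are themselves less than [r] apart. *)
  have h0 : 0 < c * r / 2 by rewrite divr_gt0// mulr_gt0.
  have [x xy] := Tdense y _ h0.
  exists x; exists (c * r / 2) => //= x' x'y.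
  rewrite -ball_normE /= rnormE ltcR -(ltr_pM2l c0).
  apply: le_lt_trans (Tc _) _; rewrite TB.
  have -> : T x - T x' = (T x - y) - (T x' - y) by rewrite opprB addrA subrK.
  by rewrite (splitr (c * r)) (le_lt_trans (ler_rnormD _ _))// rnormN ltrD.
move=> /cvg_ex[x Fx]; exists x; apply/eqP; rewrite -subr_eq0 -rnorm_eq0.
rewrite eq_le rnorm_ge0 andbT; apply/ler_addgt0Pr => e e0; rewrite add0r.
(* A Lipschitz constant for [T] that is positive whatever the sign of [C], so that one may divide by
   it. *)
pose D := `|C| + 1.
have D0 : 0 < D by rewrite ltr_wpDl.
have e20 : 0 < e / 2 by rewrite divr_gt0.
have eD0 : 0 < e / 2 / D by rewrite divr_gt0.
have F1 : F (ball x (e / 2 / D)%:C%C).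
  by apply: Fx; apply: nbhsx_ballx; rewrite (ltcR 0).
have F2 : F [set x' | rnorm (T x' - y) < e / 2] by exists (e / 2).
have [x' [/= ]] := filter_ex (filterI F1 F2).
rewrite -ball_normE /= rnormE ltcR ltr_pdivlMr// => xx' x'y.
have -> : T x - y = T (x - x') + (T x' - y) by rewrite TB addrA subrK.
rewrite (splitr e) (le_trans (ler_rnormD _ _))// lerD ?(ltW x'y)//.
apply: le_trans (TC _) _; apply: le_trans (ltW xx').
rewrite mulrC ler_wpM2l ?rnorm_ge0//.
by rewrite (le_trans (ler_norm C))// lerDl.
Qed.

End LinearOperators.

(** * Inner product estimates and almost orthogonal vectors *)

(* The minimum over t of |u - t v|^2 is |u|^2 - |<v, u>|^2 / |v|^2. *)
Lemma sqr_dot_le_dist (C : numClosedFieldType) (U : lmodType C)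
    (dot : {dot U for Num.conj}) (d : C) (u v : U) :
  (forall t, d <= dot (u - t *: v) (u - t *: v)) ->
  `|dot v u| ^+ 2 <= (dot u u - d) * dot v v.
Proof.
move=> dP; have vu : dot v u = (dot u v)^* by rewrite hermC mul1r.
have [v0|v0] := eqVneq v 0.
  by rewrite v0 !linear0l normr0 expr0n/= mulr0.
have b0 : 0 < dot v v by rewrite dnorm_gt0.
rewrite vu norm_conjC -ler_pdivrMr// lerBrDr addrC -lerBrDr.
(* The minimising [t]: the coefficient of the orthogonal projection of [u] onto the line of [v]. *)
have := dP (dot u v / dot v v).
have bR : (dot v v)^-1^* = (dot v v)^-1.
  by apply: CrealP; rewrite rpredV gtr0_real.
rewrite dnormB dnormZ linearZr_LR/= normf_div exprMn normCK (gtr0_norm b0).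
rewrite !rmorphM/= !bR conjCK.
move=> /le_trans; apply; rewrite le_eqVlt; apply/orP; left; apply/eqP.
field; exact: lt0r_neq0.
Qed.

Section Hilbert.
Context {R : realType} {H : completeNormedModType R[i]}.
Variable dot : {dot H for Num.conj}.
Hypothesis dotE : forall x : H, dot x x = `|x| ^+ 2.

Lemma rdot_le_dist (d : R) (u v : H) :
  (forall t, d <= rnorm (u - t *: v) ^+ 2) ->
  rnorm (dot v u) ^+ 2 <= (rnorm u ^+ 2 - d) * rnorm v ^+ 2.
Proof.
move=> dP; rewrite -lecR rmorphXn [leRHS]rmorphM rmorphB !rmorphXn/= -!rnormE -!dotE.
by apply: sqr_dot_le_dist => t; rewrite dotE rnormE -rmorphXn lecR.
Qed.

(** The case [d = 0] of [rdot_le_dist], where the assumed bound is the positivity of a square. *)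
Lemma rCauchySchwarz (u v : H) : rnorm (dot u v) <= rnorm u * rnorm v.
Proof.
rewrite -(@ler_pXn2r _ 2) ?nnegrE ?mulr_ge0 ?rnorm_ge0// exprMn mulrC.
by have := @rdot_le_dist 0 v u; rewrite subr0; apply => t; rewrite sqr_ge0.
Qed.

(* An approximate projection suffices: u = y0 - K x with x almost minimising
   the distance is almost orthogonal to the range of K. *)
Lemma almost_orthogonal (K : H -> H) (y0 : H) (e k : R) : linear K ->
  0 < e -> 0 < k -> (forall x, e <= rnorm (K x - y0)) ->
  exists2 y, rnorm y = 1 & forall v, rnorm (dot (K v) y) <= k * rnorm (K v).
Proof.
move=> K_linear e0 k0 Ke.
pose D := [set rnorm (K x - y0) | x in [set: H]].
have De : lbound D e by move=> _ [x _ <-].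
have Dinf : has_inf D by split; [exists (rnorm (K 0 - y0)), 0|exists e].
pose d := inf D.
have dD x : d <= rnorm (K x - y0) by apply: (inf_lbound Dinf.2); exists x.
have d0 : 0 < d by apply: lt_le_trans e0 _; apply: lb_le_inf => //; case: Dinf.
(* With [rnorm u < d * (1 + q)], the excess [rnorm u ^+ 2 - d ^+ 2] is at most
   [d ^+ 2 * (q * (2 + q))]; this [q] keeps it below [k ^+ 2 * d ^+ 2]. *)
pose q := k ^+ 2 / (2 + k ^+ 2).
have k20 : 0 < k ^+ 2 by rewrite exprn_gt0.
have q0 : 0 < q by rewrite divr_gt0// addr_gt0.
have qk : q * (2 + q) <= k ^+ 2.
  have qle : q <= k ^+ 2.
    by rewrite ler_pdivrMr ?addr_gt0//; nra.
  rewrite /q mulrAC ler_pdivrMr ?addr_gt0// ler_pM2l// lerD2l//.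
have [_ [x _ <-]] := inf_adherent (mulr_gt0 d0 q0) Dinf.
rewrite -/d => xd.
pose u := K x - y0.
have nu : 0 < rnorm u by apply: lt_le_trans (dD x).
have u0 : u != 0 by rewrite -rnorm_gt0.
exists ((rnorm u)^-1%:C%C *: u); first exact: rnorm_unit.
move=> v; rewrite linearZr_LR/= rnormM.
have -> : rnorm ((rnorm u)^-1%:C%C^* : R[i]) = (rnorm u)^-1.
  by rewrite /rnorm norm_conjC; apply: rnormC; rewrite invr_ge0 rnorm_ge0.
rewrite mulrC ler_pdivrMr//.
rewrite -(@ler_pXn2r _ 2) ?nnegrE ?mulr_ge0 ?rnorm_ge0 ?(ltW k0)//.
have : rnorm (dot (K v) u) ^+ 2 <= (rnorm u ^+ 2 - d ^+ 2) * rnorm (K v) ^+ 2.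
  apply: rdot_le_dist => t.
  rewrite ler_pXn2r ?nnegrE ?rnorm_ge0 ?(ltW d0)//.
  (* Moving [u] along the range of [K] only changes [x], so the distance stays at least the infimum
     [d]. *)
  have -> : u - t *: K v = K ((- t) *: v + x) - y0.
    by rewrite K_linear scaleNr /u addrAC; congr (_ - y0); rewrite addrC.
  exact: dD.
move=> /le_trans; apply; rewrite !exprMn mulrAC ler_wpM2r ?sqr_ge0//.
have : rnorm u < d * (1 + q) by rewrite mulrDr mulr1.
have := dD x; rewrite -/u; move: (rnorm u) => n dn nd.
apply: (@le_trans _ _ (d ^+ 2 * (q * (2 + q)))); first by nra.
rewrite mulrC; apply: ler_pM => //; [|exact: sqr_ge0|].
  by apply: ltW; rewrite mulr_gt0// addr_gt0.
by rewrite ler_pXn2r ?nnegrE ?(le_trans (ltW d0)) ?(ltW d0).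
Qed.

End Hilbert.

(** * Algebra and bounds for the resolvent of an unbounded operator *)

Section Resolvent.
Context {R : realType} {H : completeNormedModType R[i]}.
Variable A : operator H.
Implicit Types (lambda s a : R[i]) (x y : H).

Lemma operator0 : A 0 = 0.
Proof.
apply: (addIr (A 0)); rewrite add0r.
by have := app_linear 1 (dom0 A) (dom0 A); rewrite !scale1r addr0.
Qed.

Lemma shift_linear lambda a x y : dom A x -> dom A y ->
  Defs.shift A lambda (a *: x + y) = a *: Defs.shift A lambda x + Defs.shift A lambda y.
Proof.
move=> Ax Ay; rewrite /Defs.shift app_linear// scalerDr scalerBr opprD.
by rewrite addrACA !scalerA (mulrC lambda).
Qed.

Lemma domZ a x : dom A x -> dom A (a *: x).
Proof. by move=> Ax; rewrite -[_ *: _]addr0; apply: dom_linear => //; apply: dom0. Qed.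

Lemma shift0 lambda : Defs.shift A lambda 0 = 0.
Proof. by rewrite /Defs.shift operator0 scaler0 subr0. Qed.

Lemma shiftZ lambda a x : dom A x ->
  Defs.shift A lambda (a *: x) = a *: Defs.shift A lambda x.
Proof.
by move=> Ax; rewrite -[a *: x]addr0 shift_linear ?shift0 ?addr0//; apply: dom0.
Qed.

Section ResolventSet.
Variable s : R[i].
Hypothesis sA : resolvent_set A s.
Let T := resolvent A s.

Lemma resolvent_dom x : dom A (T x).
Proof.
case: sA => -[_ _ surj] _.
by apply: (surjpinv_image_sub (dflt := fun=> 0) surj); exists x.
Qed.

Lemma resolventK x : Defs.shift A s (T x) = x.
Proof.
case: sA => -[_ _ surj] _.
by apply: (surjpK (fun=> 0) surj); rewrite in_setE.
Qed.

Lemma shiftK x : dom A x -> T (Defs.shift A s x) = x.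
Proof.
case: sA => -[_ inj _] _ Ax.
by apply: (pinvKV (fun=> 0) inj); rewrite in_setE.
Qed.

Lemma resolvent_linear : linear T.
Proof.
move=> a x y; rewrite -{1}(resolventK x) -{1}(resolventK y) -shift_linear.
- by rewrite shiftK//; apply: dom_linear; apply: resolvent_dom.
- exact: resolvent_dom.
- exact: resolvent_dom.
Qed.

Lemma resolvent_opnorm x : rnorm (T x) <= opnorm T * rnorm x.
Proof. by apply: opnorm_bound; [apply: resolvent_linear|case: sA]. Qed.

(** A zero norm would force [T x = 0], yet [A - s] maps [T x] back to [x]. The vector [x] witnesses
    that [H] is nontrivial. *)
Lemma opnorm_resolvent_gt0 x : x != 0 -> 0 < opnorm T.
Proof.
move=> x0; rewrite lt_def opnorm_ge0 ?andbT; last 2 first.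
- exact: resolvent_linear.
- by case: sA.
apply/eqP => T0; move/eqP: x0; apply.
have Tx0 : T x = 0.
  apply/eqP; rewrite -rnorm_eq0 eq_le rnorm_ge0 andbT.
  by rewrite (le_trans (resolvent_opnorm x))// T0 mul0r.
by rewrite -(resolventK x) Tx0 shift0.
Qed.

(** Writing [A - lambda] as [(A - s) - (lambda - s)] replaces an unbounded operator by an everywhere
    defined bounded one. *)
Lemma shift_resolvent lambda x :
  Defs.shift A lambda (T x) = x - (lambda - s) *: T x.
Proof.
by rewrite -{2}(resolventK x) /Defs.shift scalerBl opprB addrA subrK.
Qed.

End ResolventSet.

(** The lower bound yields both injectivity and the bound [e^-1] for the inverse. *)
Lemma resolvent_set_of_bound lambda (e : R) : 0 < e ->
  (forall x, dom A x -> e * rnorm x <= rnorm (Defs.shift A lambda x)) ->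
  (forall y, exists2 x, dom A x & Defs.shift A lambda x = y) ->
  resolvent_set A lambda.
Proof.
move=> e0 lower surj.
have bij : set_bij (dom A) [set: H] (Defs.shift A lambda).
  split=> //; last by move=> y _; have [x Ax <-] := surj y; exists x.
  move=> x y; rewrite !in_setE => Ax Ay xy.
  apply/eqP; rewrite -subr_eq0 -rnorm_eq0 eq_le rnorm_ge0 andbT.
  rewrite -(ler_pM2l e0) mulr0.
  have -> : x - y = (-1) *: y + x by rewrite scaleN1r addrC.
  apply: le_trans (lower _ _) _; first exact: dom_linear.
  by rewrite shift_linear// xy scaleN1r addNr rnorm0.
split=> //; exists e^-1 => x.
have [_ _ sj] := bij.
rewrite -ler_pdivrMl ?invr_gt0// invrK.
have Rx : dom A (resolvent A lambda x).
  by apply: (surjpinv_image_sub (dflt := fun=> 0) sj); exists x.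
apply: le_trans (lower _ Rx) _.
by rewrite (surjpK (fun=> 0) sj)// in_setE.
Qed.

Lemma opnorm_resolvent_le lambda (e : R) : 0 < e -> resolvent_set A lambda ->
  (forall x, dom A x -> e * rnorm x <= rnorm (Defs.shift A lambda x)) ->
  opnorm (resolvent A lambda) <= e^-1.
Proof.
move=> e0 lambdaA lower; apply: opnorm_le => [|x]; first by rewrite invr_ge0 ltW.
rewrite -ler_pdivrMl ?invr_gt0// invrK.
by rewrite -[in leRHS](resolventK lambdaA x) lower//; apply: resolvent_dom.
Qed.

(* With T = (A - s)^-1, the operator 1 - (lambda - s) T = (A - lambda) T is
   bounded below; were its range dense, it would be onto. *)
Lemma spectrum_range_not_dense lambda s (e : R) : 0 < e -> resolvent_set A s ->
  spectrum A lambda ->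
  (forall x, dom A x -> e * rnorm x <= rnorm (Defs.shift A lambda x)) ->
  exists y0 (r : R), 0 < r /\
    forall x, r <= rnorm (x - (lambda - s) *: resolvent A s x - y0).
Proof.
move=> e0 sA lambdaA lower; apply: contrapT => far; apply: lambdaA.
pose T := resolvent A s; pose a := lambda - s; pose K x := x - a *: T x.
have T_linear : linear T := resolvent_linear sA.
have K_linear : linear K := linear_id_subZ T_linear a.
have shiftT x : Defs.shift A lambda (T x) = K x by exact: shift_resolvent.
have K_upper x : rnorm (K x) <= (1 + rnorm a * opnorm T) * rnorm x.
  rewrite (le_trans (ler_rnormD _ _))// rnormN rnormZ mulrDl mul1r lerD2l//.
  by rewrite -mulrA ler_wpM2l ?rnorm_ge0// resolvent_opnorm.
(* From [x = K x + a *: T x] and [e * rnorm (T x) <= rnorm (K x)] follows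
   [rnorm x <= C * rnorm (K x)]. *)
pose C := 1 + rnorm a / e.
have C0 : 0 < C by rewrite ltr_wpDr// divr_ge0 ?rnorm_ge0 ?ltW.
have K_lower x : C^-1 * rnorm x <= rnorm (K x).
  rewrite mulrC ler_pdivrMr// -{1}(subrK (a *: T x) x) -/(K x).
  rewrite (le_trans (ler_rnormD _ _))// mulrDr mulr1 lerD2l// rnormZ.
  rewrite mulrCA ler_wpM2l ?rnorm_ge0// ler_pdivlMr// mulrC -shiftT.
  by apply: lower; apply: resolvent_dom.
have K_dense y r : 0 < r -> exists x, rnorm (K x - y) < r.
  move=> r0; apply: contrapT => farK; apply: far; exists y, r; split=> // x.
  by rewrite leNgt; apply/negP => Kx; apply: farK; exists x.
have C10 : 0 < C^-1 by rewrite invr_gt0.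
apply: (resolvent_set_of_bound e0 lower) => y.
have [x <-] := dense_range_surj K_linear C10 K_upper K_lower K_dense y.
by exists (T x); [apply: resolvent_dom|apply: shiftT].
Qed.

(** * Points of the numerical range close to [a^-1] *)

Section NumericalRange.
Variable dot : {dot H for Num.conj}.
Hypothesis dotE : forall x : H, dot x x = `|x| ^+ 2.
Variables (s lambda : R[i]) (eps : R).
Hypotheses (sA : resolvent_set A s) (neq : lambda - s != 0) (eps_gt0 : 0 < eps).
Hypothesis eps_lt : opnorm (resolvent A s) * eps < 1.
Let T := resolvent A s.
Let a := lambda - s.

Lemma delta_gt0 x : x != 0 -> 0 < delta_ A eps s.
Proof.
move=> /(opnorm_resolvent_gt0 sA) T0.
by rewrite /delta_ divr_gt0 ?mulr_gt0 ?exprn_gt0// subr_gt0.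
Qed.

Lemma approx_eigenvector x : dom A x -> rnorm x = 1 ->
  rnorm (Defs.shift A lambda x) < eps ->
  rnorm (a^-1 - dot (T x) x) < delta_ A eps s.
Proof.
move=> Ax x1 xe; have x0 : x != 0 by rewrite -rnorm_gt0 x1.
have T0 := opnorm_resolvent_gt0 sA x0.
set y := Defs.shift A lambda x in xe.
(* Obtained by applying [T] to [(A - s) x = a *: x + y]. *)
have xE : x = T y + a *: T x.
  have -> : T y + a *: T x = a *: T x + T y by rewrite addrC.
  rewrite -resolvent_linear//.
  have -> : a *: x + y = Defs.shift A s x.
    by rewrite /y /Defs.shift /a scalerBl addrC addrA subrK.
  by rewrite shiftK.
have Ty : rnorm (T y) < opnorm T * eps.
  by rewrite (le_lt_trans (resolvent_opnorm sA y))// ltr_pM2l.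
have dxx : dot x x = 1 by rewrite dotE rnormE x1 expr1n.
have awE : 1 - a * dot (T x) x = dot (T y) x.
  have := congr1 (dot^~ x) xE; rewrite /= dxx linearDl linearZl_LR/= => ->.
  by rewrite addrK.
have a_lower : 1 - opnorm T * eps <= rnorm a * opnorm T.
  rewrite lerBlDl -{1}x1 {1}xE (le_trans (ler_rnormD _ _))// lerD ?(ltW Ty)//.
  rewrite rnormZ ler_wpM2l ?rnorm_ge0// (le_trans (resolvent_opnorm sA x))//.
  by rewrite x1 mulr1.
apply: rnorm_inv_sub => //; rewrite awE.
apply: le_lt_trans (rCauchySchwarz dotE _ _) _; rewrite x1 mulr1.
apply: lt_le_trans Ty _; rewrite /delta_ -/T.
(* Clearing the denominator of [delta_] and cancelling [opnorm T] and [eps] leaves exactly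
   [a_lower]. *)
rewrite mulrAC ler_pdivlMr ?subr_gt0// expr2 -!mulrA ler_pM2l// mulrCA.
by rewrite ler_pM2l// [leRHS]mulrC.
Qed.

Lemma residual_vector : spectrum A lambda ->
  (forall x, dom A x -> eps * rnorm x <= rnorm (Defs.shift A lambda x)) ->
  exists2 y, rnorm y = 1 & rnorm (a^-1 - dot (T y) y) < delta_ A eps s.
Proof.
move=> lambdaA lower.
have [y0 [r [r0 far]]] := spectrum_range_not_dense eps_gt0 sA lambdaA lower.
pose K x := x - a *: T x.
have T_linear : linear T := resolvent_linear sA.
have K_linear : linear K := linear_id_subZ T_linear a.
(* [K 0 = 0] is at distance at least [r] from [y0]. A nonzero vector makes [opnorm T] and [delta_]
   positive. *)
have y00 : - y0 != 0.
  rewrite -rnorm_gt0 (lt_le_trans r0)// (le_trans (far 0))//.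
  by rewrite linear_op0// scaler0 subrr add0r.
have d0 := delta_gt0 y00.
have T0 : 0 < opnorm T := opnorm_resolvent_gt0 sA y00.
have a0 : 0 < rnorm a by rewrite rnorm_gt0.
pose c := 1 + rnorm a * opnorm T.
have c0 : 0 < c by rewrite addr_gt0// mulr_gt0.
(* As [c] bounds [K] on unit vectors, the inner product is at most [k * c], half of
   [delta_ A eps s * rnorm a]; the half gives strictness. *)
pose k := delta_ A eps s * rnorm a / 2 / c.
have k0 : 0 < k by rewrite !divr_gt0// mulr_gt0.
have [y y1 Ky] := almost_orthogonal dotE K_linear r0 k0 far.
exists y => //; apply: rnorm_inv_sub => //.
have -> : 1 - a * dot (T y) y = dot (K y) y.
  by rewrite /K (linearBl dot) linearZl_LR/= dotE rnormE y1 expr1n.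
apply: le_lt_trans (Ky y) _.
have Kyc : rnorm (K y) <= c.
  rewrite (le_trans (ler_rnormD _ _))// rnormN rnormZ y1 lerD2l//.
  rewrite ler_wpM2l ?rnorm_ge0// (le_trans (resolvent_opnorm sA y))//.
  by rewrite y1 mulr1.
apply: (@le_lt_trans _ _ (k * c)); first by rewrite ler_pM2l.
rewrite divfK ?gt_eqF//; have : 0 < delta_ A eps s * rnorm a by rewrite mulr_gt0.
by lra.
Qed.

End NumericalRange.
End Resolvent.

(** * Assembling the two cases into the inclusion *)

Lemma bounded_below_of_no_approx_eigenvector (R : realType)
    (H : completeNormedModType R[i]) (A : operator H) (lambda : R[i]) (eps : R) :
  (forall x, dom A x -> rnorm x = 1 -> eps <= rnorm (Defs.shift A lambda x)) ->
  forall x, dom A x -> eps * rnorm x <= rnorm (Defs.shift A lambda x).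
Proof.
move=> lower x Ax; have [->|x0] := eqVneq x 0.
  by rewrite rnorm0 mulr0 rnorm_ge0.
have := lower _ (domZ (rnorm x)^-1%:C%C Ax) (rnorm_unit x0).
rewrite shiftZ// rnormZ rnormC ?invr_ge0 ?rnorm_ge0// mulrC.
by rewrite ler_pdivlMr// rnorm_gt0.
Qed.

Theorem theorem2p2 (R : realType) (H : completeNormedModType R[i])
    (dot : {dot H for Num.conj}) (dotE : forall x : H, dot x x = `|x| ^+ 2)
    (A : operator H) (closedA : closed_operator A)
    (denseA : densely_defined A)
    (S : set R[i]) (S_sub : S `<=` resolvent_set A)
    (M_fin : has_ubound [set opnorm (resolvent A s) | s in S])
    (eps : R) (eps_gt0 : 0 < eps)
    (* extended-real inverse: 1 / M = +oo when M = 0 *)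
    (eps_lt : (eps%:E < (resolvent_bound A S)%:E^-1)%E) :
  pseudospectrum A eps `<=`
    \bigcap_(s in S)
      translate
        (inv_set (nbhd_set (delta_ A eps s)
                    (numerical_range dot [set: H] (resolvent A s))))
        s.
Proof.
move=> lambda lambda_pseudo s Ss.
have sA := S_sub s Ss.
have small : opnorm (resolvent A s) * eps < 1.
  (* The nonpositive case is separated because [M] may then be 0, with inverse +oo; otherwise [M] is
     positive and its inverse real. *)
  have [T0|T0] := leP (opnorm (resolvent A s)) 0.
    by rewrite (le_lt_trans _ ltr01)// mulr_le0_ge0// ltW.
  have TM : opnorm (resolvent A s) <= resolvent_bound A S.
    by apply: (ub_le_sup M_fin); exists s.
  have M0 : 0 < resolvent_bound A S := lt_le_trans T0 TM.
  apply: (@le_lt_trans _ _ (resolvent_bound A S * eps)).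
    by rewrite ler_pM2r.
  move: eps_lt; rewrite inver gt_eqF// lte_fin => eps_lt_inv.
  by rewrite mulrC -ltr_pdivlMr// div1r.
(* The point [s] itself is outside the pseudospectrum: it is in the resolvent set, and [small] says
   that its resolvent has norm below [eps^-1]. *)
have neq : lambda - s != 0.
  rewrite subr_eq0; apply/eqP => lambda_eq.
  case: lambda_pseudo => [|[_]]; rewrite lambda_eq; first by apply.
  move: small; rewrite -ltr_pdivlMr// div1r => Ts /lt_trans/(_ Ts).
  by rewrite ltxx.
suff [x x1 xP] : exists2 x, rnorm x = 1 &
    rnorm ((lambda - s)^-1 - dot (resolvent A s x) x) < delta_ A eps s.
  exists (lambda - s); last by rewrite subrK.
  exists (lambda - s)^-1; last by rewrite invrK.
  split; last by apply/eqP; rewrite invr_eq0.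
  apply: le_lt_trans (_ : (_ <= (rnorm ((lambda - s)^-1 -
    dot (resolvent A s x) x))%:E)%E) _; last by rewrite lte_fin.
  by apply: ereal_inf_lbound; exists (dot (resolvent A s x) x) => //; exists x.
have [[x [Ax x1 xe]]|far] := pselect (exists x, [/\ dom A x, rnorm x = 1 &
    rnorm (Defs.shift A lambda x) < eps]).
  exists x => //; exact: approx_eigenvector.
have lower : forall x, dom A x -> eps * rnorm x <= rnorm (Defs.shift A lambda x).
  apply: bounded_below_of_no_approx_eigenvector => x Ax x1.
  by rewrite leNgt; apply/negP => xe; apply: far; exists x.
(* By [lower], a resolvent at [lambda] would have norm at most [eps^-1], so [lambda] can only be in
   the spectrum. *)
apply: residual_vector => //; case: lambda_pseudo => // -[lambdaA].
by rewrite ltNge opnorm_resolvent_le.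
Qed.
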